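(* Let $X$ be a finite-dimensional real Banach space and let $(x_n)_{n=1}^\infty$ be a sequence of points of $X$. Let $\Sigma\subseteq X$ be the set of all potential sums of the series $\sum_{n=1}^\infty x_n$, let $$\Gamma=\Big\{f\in X^*:\sum_{n=1}^\infty|f(x_n)|<\infty\Big\},\qquad \Gamma^\perp=\bigcap_{f\in\Gamma}f^{-1}(0).$$ Then $\Sigma$ is an affine subspace of $X$ (possibly empty) and $\Sigma=\Sigma+\Gamma^\perp$. Moreover, $\Sigma$ is non-empty if and only if the series $\sum_{n=1}^\infty x_n$ is $*$-potentially convergent.
   Context: $X^*$ denotes the dual Banach space of $X$ (continuous linear functionals $X\to\mathbb R$). A series $\sum_{n=1}^\infty x_n$ in a Banach space $X$ is potentially convergent to a point $x\in X$ if for some permutation $\sigma$ of $\mathbb N=\{1,2,\dots\}$ the sequence of partial sums $\big(\sum_{n=1}^m x_{\sigma(n)}\big)_{m=1}^\infty$ converges to $x$; in this case $x$ is called a potential sum of the series. The series is $*$-potentially convergent if for every $f\in X^*$ the series of reals $\sum_{n=1}^\infty f(x_n)$ is potentially convergent to some real number (the permutation may depend on $f$). A subset $A$ of a linear space $X$ is called affine if $\sum_{i=1}^n t_ia_i\in A$ for all $n\in\mathbb N$, all $a_1,\dots,a_n\in A$ and all real numbers $t_1,\dots,t_n$ with $\sum_{i=1}^n t_i=1$; in particular the empty set is affine. For subsets $A,B\subseteq X$, $A+B=\{a+b:a\in A,\ b\in B\}$. *)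

(* Defs.v *)
From mathcomp Require Import all_boot all_order all_algebra.
From mathcomp Require Import all_classical all_reals all_analysis.
Set Implicit Arguments.
Unset Strict Implicit.
Unset Printing Implicit Defensive.
Import Order.TTheory GRing.Theory Num.Theory.
Import numFieldNormedType.Exports.
Local Open Scope classical_set_scope.
Local Open Scope ring_scope.

(* [Vector.axiom n X] lives in Type: it packages a linear bijection
   X -> 'rV[R]_n.  [inhabited] forgets the choice of coordinates. *)
Definition finite_dimensional (R : realType) (X : lmodType R) : Prop :=
  exists n : nat, inhabited (Vector.axiom n X).

(* Sequences are indexed from 0, and [series u m] is the sum of the first m
   terms of u. *)
Definition potential_sums (R : realType) (X : normedModType R)
    (x : nat -> X) : set X :=
  [set s | exists sigma : nat -> nat,
      bijective sigma /\ series (x \o sigma) @ \oo --> s].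

Definition topological_dual (R : realType) (X : normedModType R) :
    set {linear X -> R^o} :=
  [set f | continuous f].

Definition star_potentially_convergent (R : realType) (X : normedModType R)
    (x : nat -> X) : Prop :=
  forall f : {linear X -> R^o}, topological_dual f ->
    exists r : R, potential_sums (f \o x : nat -> R^o) r.

(* The case n = 0 is vacuous, since the empty sum of coefficients is 0. *)
Definition affine_set (R : realType) (X : lmodType R) (A : set X) : Prop :=
  forall (n : nat) (a : 'I_n -> X) (t : 'I_n -> R),
    (forall i, A (a i)) -> \sum_(i < n) t i = 1 ->
    A (\sum_(i < n) t i *: a i).

Definition set_sum (X : zmodType) (A B : set X) : set X :=
  [set a + b | a in A & b in B].

Definition Gamma (R : realType) (X : normedModType R) (x : nat -> X) :
    set {linear X -> R^o} :=
  [set f | topological_dual f /\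
           (\sum_(0 <= n <oo) (`|f (x n)| : R)%:E < +oo)%E].

Definition Gamma_perp (R : realType) (X : normedModType R) (x : nat -> X) :
    set X :=
  \bigcap_(f in Gamma x) (f @^-1` [set 0]).

(* Main.v *)
From HB Require Import structures.
Require Import Defs.
From mathcomp Require Import all_boot all_order all_algebra.
From mathcomp Require Import all_classical all_reals all_analysis.
From mathcomp Require Import lra ring.

(** Everything reduces to one description of the set of potential sums: if the
    series is *-potentially convergent, then [s] is a potential sum exactly when
    [f s] is the sum of the absolutely convergent series [f (x n)] for every
    [f] in [Gamma x] ([potential_sumsP]).  These conditions on [s] are affine
    and depend on [s] only modulo [Gamma_perp x].  They have a solution, because
    summing [f (x n)] is a linear form on the subspace [Gamma x] of a
    finite-dimensional dual, so it is evaluation at some point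
    ([potential_sum_exists]).

    One direction holds because an absolutely convergent series has the same sum
    in every order ([Gamma_sum]).  For the other direction, work in R^n with the
    functionals [dot u] and the sequence [y] of the coordinates of [x].  Fix [N],
    and consider the convex set of all sums of [l i *: y i] over finitely many
    [i >= N], with weights [l i] in [0, 1].  The point [s - series y N] lies
    in its closure ([weighted_tails_closure]): otherwise some [dot u] separates them, and
    - if [dot u (y i)] is absolutely summable, its tail sums are values of
      [dot u] on the convex set and converge to the value of [dot u] at
      [s - series y N];
    - if not, potential convergence forces its positive terms to have an
      infinite sum ([bounded_pos_abs]), so [dot u] is unbounded above on the
      convex set.

    Next, the weights are replaced by 0 and 1.  A weighted sum of vectors of R^n
    can be rewritten with the same value and at most [n] weights strictly
    between 0 and 1 ([few_fractional_weights]), so dropping these costs at most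
    [n] times the largest vector involved ([rounding]).  Since the terms tend to
    0, any finite set of indices is contained in one whose sum is as close to
    [s] as desired ([approx_finite]).  This produces an increasing sequence of
    finite sets that exhausts the indices and whose sums converge to [s].

    Finally, inside each block between two consecutive finite sets the terms are
    ordered by Steinitz's lemma ([steinitz]), which keeps every intermediate sum
    within a bound given by the total of the block and the size of its terms.
    Both tend to 0, so all partial sums converge to [s]
    ([approximable_potential]). *)

Set Implicit Arguments.
Unset Strict Implicit.
Unset Printing Implicit Defensive.
Import Order.TTheory GRing.Theory Num.Theory.
Import numFieldNormedType.Exports.
Local Open Scope ring_scope.

(** * Weighted sums with few fractional weights *)

Lemma linear_dependence (R : fieldType) (T : finType) d (y : T -> 'rV[R]_d)
    (A : {set T}) : (d < #|A|)%N ->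
  exists c : T -> R, [/\ exists i, c i != 0, forall i, i \notin A -> c i = 0 &
    \sum_i c i *: y i = 0].
Proof.
move=> dA; pose B : 'M[R]_(#|A|, d) := \matrix_k y (enum_val k).
have /rowV0Pn[v /sub_kermxP vB v0] : kermx B != 0.
  rewrite -mxrank_eq0 mxrank_ker subn_eq0 -ltnNge.
  exact: leq_ltn_trans (rank_leq_col _) dA.
exists (fun i => \sum_(k | enum_val k == i) v 0 k); split.
- have [k vk0] := rV0Pn _ v0; exists (enum_val k).
  by rewrite (big_pred1 k)// => j; rewrite (inj_eq enum_val_inj).
- move=> i iA; rewrite big1// => k /eqP ki; move: iA.
  by rewrite -ki enum_valP.
- under eq_bigr do rewrite scaler_suml.
  rewrite -[RHS]vB mulmx_sum_row.
  rewrite (partition_big (fun k : 'I_#|A| => enum_val k) predT)//=.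
  by apply: eq_bigr => i _; apply: eq_bigr => k /eqP <-; rewrite rowK.
Qed.

(** While more than [d] weights are strictly inside (0, 1), the vectors carrying
    them are linearly dependent.  Moving along a dependence keeps the weighted
    sum; stopping when the first weight reaches 0 or 1 leaves fewer fractional
    weights. *)
Lemma few_fractional_weights (R : realFieldType) (T : finType) d (y : T -> 'rV[R]_d)
    (l : T -> R) : (forall i, 0 <= l i <= 1) ->
  exists m : T -> R, [/\ forall i, 0 <= m i <= 1,
    forall i, ~~ (0 < l i < 1) -> m i = l i,
    \sum_i m i *: y i = \sum_i l i *: y i &
    (#|[set i | (0 < m i < 1)%R]| <= d)%N].
Proof.
have [N] := ubnP #|[set i | (0 < l i < 1)%R]|; elim: N l => // N IH l lN l01.
have [ld|dl] := leqP #|[set i | 0 < l i < 1]| d; first by exists l.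
have [c [[j cj] cA cy]] := linear_dependence y dl.
(* [tau i] is the time at which the weight [i], moving with speed [c i],
   leaves [0, 1]. *)
pose tau i : R := if 0 < c i then (1 - l i) / c i else l i / - c i.
have [i0 ci0 taumin] := @Order.TotalTheory.arg_minP _ _ _ j (fun i => c i != 0) tau cj.
have l01' i : c i != 0 -> 0 < l i < 1.
  by apply: contraNT => li; rewrite cA// inE.
have tau0 : 0 < tau i0.
  rewrite /tau; have /andP[l0 l1] := l01' _ ci0.
  case: ifPn => c0; apply: divr_gt0 => //; first by rewrite subr_gt0.
  by rewrite oppr_gt0 lt_neqAle ci0 leNgt.
pose m i : R := l i + tau i0 * c i.
have m01 i : 0 <= m i <= 1.
  rewrite /m; have [->|ci] := eqVneq (c i) 0; first by rewrite mulr0 addr0.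
  have := taumin _ ci; have /andP[l0 l1] := l01' _ ci.
  rewrite /(tau i); case: ifPn => c0.
    rewrite ler_pdivlMr// => h; have := mulr_gt0 tau0 c0; lra.
  have {}c0 : 0 < - c i by rewrite oppr_gt0 lt_neqAle ci leNgt.
  rewrite ler_pdivlMr// => h; have := mulr_gt0 tau0 c0; lra.
have mi0 : ~~ (0 < m i0 < 1).
  rewrite /m /tau; case: ifPn => c0.
    by rewrite divfK// subrKC ltxx andbF.
  by rewrite invrN mulrN mulNr divfK// subrr ltxx.
have ml i : ~~ (0 < l i < 1) -> m i = l i.
  move=> li; rewrite /m cA ?mulr0 ?addr0// inE//.
have mN : (#|[set i | (0 < m i < 1)%R]| < N)%N.
  rewrite -ltnS (leq_trans _ lN)// ltnS; apply: proper_card.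
  apply/properP; split.
    apply/fintype.subsetP => i; rewrite !inE; apply: contraTT => li.
    by rewrite ml.
  by exists i0; rewrite !inE// l01'.
have [m' [h1 h2 h3 h4]] := IH _ mN m01.
exists m'; split=> //.
  by move=> i li; rewrite h2 ml.
rewrite h3 /m; under eq_bigr do rewrite scalerDl -scalerA.
by rewrite big_split/= -scaler_sumr cy scaler0 addr0.
Qed.

(** * Rounding weights and Steinitz's lemma *)

(** [H] collects the weights equal to 1 after [few_fractional_weights]; the at
    most [d] fractional ones are replaced by 0, at a cost of [M] each. *)
Lemma rounding (R : realType) (T : finType) d (y : T -> 'rV[R]_d)
    (l : T -> R) (M : R) : 0 <= M -> (forall i, 0 <= l i <= 1) ->
  (forall i, l i != 0 -> `|y i| <= M) ->
  exists H : {set T}, (forall i, i \in H -> l i != 0) /\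
    `|\sum_i l i *: y i - \sum_(i in H) y i| <= M *+ d.
Proof.
move=> M0 l01 yM; have [m [m01 ml my mfrac]] := few_fractional_weights y l01.
have ml0 i : l i = 0 -> m i = 0 by move=> li; rewrite ml li// ltxx.
exists [set i | m i == 1]; split.
  by move=> i; rewrite inE => /eqP mi; apply/eqP => /ml0; rewrite mi => /eqP; rewrite oner_eq0.
rewrite -my [X in X - _](bigID (fun i => i \in [set i | m i == 1]))/=.
rewrite [X in X + _ - _](eq_bigr y); last first.
  by move=> i; rewrite inE => /eqP ->; rewrite scale1r.
rewrite addrC addKr.
rewrite (bigID (fun i => i \in [set i | 0 < m i < 1]))/= [X in _ + X]big1 ?addr0; last first.
  move=> i; rewrite !inE !lt_neqAle => /andP[mi1]; have /andP[-> ->] := m01 i.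
  by rewrite mi1 !andbT negbK => /eqP <-; rewrite scale0r.
apply: (le_trans (ler_norm_sum _ _ _)).
apply: (@le_trans _ _ (\sum_(i in [set i | 0 < m i < 1]) M)).
  rewrite [leRHS](bigID (fun i => i \in [set i | m i == 1]))/= [leRHS]addrC.
  rewrite (eq_bigl (fun i =>
    (i \in [set i | 0 < m i < 1]) && (i \notin [set i | m i == 1]))); last first.
    by move=> i; rewrite andbC.
  rewrite -[leLHS]addr0 lerD ?sumr_ge0// ler_sum// => i; rewrite !inE => /andP[/andP[mi0 mi1] _].
  rewrite normrZ gtr0_norm// (le_trans (ler_piMl _ (ltW mi1)))//.
  by apply: yM; apply: contraTN mi0 => /eqP /ml0 ->; rewrite ltxx.
by rewrite sumr_const ler_wpMn2l.
Qed.

(** One step of the Grinberg-Sevastyanov proof of Steinitz's lemma.  A set of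
    [k.+1] vectors carries weights of total at least [k.+1 - d]; one index can be
    removed so that the remaining [k] vectors carry weights of total at least
    [k - d], without increasing the norm of the weighted sum.  If [k <= d], zero
    weights will do.  Otherwise the weights are scaled down to total [k - d], then
    made mostly integral with both the weighted sum and the total fixed.  If no
    weight were 0, the [k.+1] defects [1 - m i] would come from the at most [d.+1]
    fractional weights, each contributing less than 1, which contradicts their
    total [d.+1]. *)
Lemma steinitz_drop_index (R : realType) (T : finType) d (y : T -> 'rV[R]_d) (A : {set T})
    (l : T -> R) (k : nat) : #|A| = k.+1 ->
  (forall i, 0 <= l i <= 1) -> (forall i, i \notin A -> l i = 0) ->
  k.+1%:R <= \sum_i l i + d%:R ->
  exists (i : T) (m : T -> R), [/\ i \in A,
    (forall i, 0 <= m i <= 1), (forall j, j \notin A :\ i -> m j = 0),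
    k%:R <= \sum_i m i + d%:R & `|\sum_i m i *: y i| <= `|\sum_i l i *: y i| ].
Proof.
move=> Ak l01 lA lk.
have [kd|dk] := leqP k d.
  have /finset.set0Pn[i iA] : A != finset.set0 by rewrite -card_gt0 Ak.
  exists i, (fun=> 0); split=> //; first by move=> _; rewrite lexx ler01.
    by rewrite big1// add0r ler_nat.
  by rewrite big1 ?normr0// => j _; rewrite scale0r.
have kd0 : 0 < k%:R - d%:R :> R by rewrite subr_gt0 ltr_nat.
set S := \sum_i l i in lk *.
have SS : k%:R - d%:R + 1 <= S.
  by move: lk; rewrite -natr1; lra.
have S0 : 0 < S by lra.
pose a := (k%:R - d%:R) / S.
have a0 : 0 <= a by rewrite divr_ge0// ltW.
have a1 : a <= 1 by rewrite ler_pdivrMr// mul1r; lra.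
have al01 i : 0 <= a * l i <= 1.
  by have /andP[l0 l1] := l01 i; rewrite mulr_ge0// mulr_ile1.
(* The extra coordinate 1 keeps the total of the weights fixed. *)
have [m [m01 ml my mfrac]] :=
  few_fractional_weights (fun i => row_mx (y i) (const_mx 1 : 'rV[R]_1)) al01.
have m0 i : i \notin A -> m i = 0.
  by move=> iA; rewrite ml lA// mulr0// ltxx.
have mS : \sum_i m i = k%:R - d%:R.
  have /(congr1 (fun v : 'rV_(d + 1) => v 0 (rshift d ord0))) := my.
  rewrite !summxE.
  under eq_bigr do rewrite mxE row_mxEr mxE mulr1.
  under [in RHS]eq_bigr do rewrite mxE row_mxEr mxE mulr1.
  by rewrite -mulr_sumr -/S /a divfK// gt_eqF.
have mY : \sum_i m i *: y i = a *: \sum_i l i *: y i.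
  have /(congr1 lsubmx) := my.
  rewrite !linear_sum/=.
  under eq_bigr do rewrite linearZ/= row_mxKl.
  under [in RHS]eq_bigr do rewrite linearZ/= row_mxKl -scalerA.
  by rewrite -scaler_sumr.
have [i iA mi0] : exists2 i, i \in A & m i = 0.
  apply: contrapT => no0.
  have mA : \sum_(i in A) (1 - m i) = d.+1%:R.
    rewrite sumrB sumr_const Ak.
    have -> : \sum_(i in A) m i = \sum_i m i.
      by rewrite [LHS]big_mkcond; apply: eq_bigr => i _; case: ifPn => // /m0.
    by rewrite mS -!natr1; lra.
  have mF : \sum_(i in [set i | 0 < m i < 1]) (1 - m i) = d.+1%:R.
    rewrite -mA [LHS]big_mkcond [RHS]big_mkcond/=; apply: eq_bigr => i _; rewrite inE.
    have /andP[mi0 mi1] := m01 i.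
    case: ifPn => [/andP[mi _]|]; case: ifPn => // iA.
      by move: mi; rewrite m0// ltxx.
    have {}mi0 : 0 < m i.
      by rewrite lt_neqAle mi0 andbT eq_sym; apply/eqP => mi0'; apply: no0; exists i.
    by rewrite mi0/= -leNgt => mi; rewrite (@le_anti _ _ (m i) 1) ?mi ?mi1// subrr.
  have [F0|F0] := eqVneq [set i | 0 < m i < 1] finset.set0.
    move: mF; rewrite F0 big_set0 => /esym/eqP; by rewrite pnatr_eq0.
  have : \sum_(i in [set i | 0 < m i < 1]) (1 - m i) < \sum_(i in [set i | 0 < m i < 1]) 1.
    apply: ltr_sum => [|i]; last by rewrite inE => /andP[? _]; lra.
    by have /finset.set0Pn[i iF] := F0; apply/hasP; exists i => //; rewrite mem_index_enum.
  by rewrite mF sumr_const ltr_nat ltnNge -addn1 mfrac.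
exists i, m; split=> //.
- by move=> j; rewrite !inE negb_and negbK => /orP[/eqP ->//|]; exact: m0.
- by rewrite mS subrK.
- by rewrite mY normrZ ger0_norm// ler_piMl.
Qed.

(** Indices are removed one at a time, and the removed ones, read backwards, give
    the ordering.  The vectors indexed by the current set [A] then form an initial
    segment.  Their sum differs from the weighted sum, bounded by [B], by the sum
    of the [(1 - l i) *: y i], which is at most [M *+ d] since the defects
    [1 - l i] add up to at most [d]. *)
Lemma steinitz_chain (R : realType) (T : finType) d (y : T -> 'rV[R]_d) (M B : R)
    (A : {set T}) (l : T -> R) : 0 <= M -> (forall i, `|y i| <= M) ->
  (forall i, 0 <= l i <= 1) -> (forall i, i \notin A -> l i = 0) ->
  #|A|%:R <= \sum_i l i + d%:R -> `|\sum_i l i *: y i| <= B ->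
  exists t : seq T, perm_eq t (enum A) /\
    forall j, `|\sum_(i <- take j t) y i| <= B + M *+ d.
Proof.
move=> M0 yM; have [k Ak] : exists k, #|A| = k by exists #|A|.
elim: k A l Ak => [|k IH] A l Ak l01 lA lk lB.
  exists [::]; rewrite (cards0_eq Ak) enum_set0; split=> // j.
  by rewrite big_nil normr0 addr_ge0 ?mulrn_wge0// (le_trans _ lB).
have lk' := lk; rewrite Ak in lk'.
have [i [m [iA m01 mA mk mB]]] := steinitz_drop_index y Ak l01 lA lk'.
have Aik : #|A :\ i| = k by move: Ak; rewrite (cardsD1 i) iA => -[].
have [||t [tA tB]] := IH (A :\ i) m Aik m01 mA.
- by rewrite Aik.
- exact: le_trans mB lB.
have tiA : perm_eq (rcons t i) (enum A).
  have it : i \notin t by rewrite (perm_mem tA) mem_enum !inE eqxx.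
  apply: uniq_perm; rewrite ?enum_uniq// ?rcons_uniq ?it/=.
    by rewrite (perm_uniq tA) enum_uniq.
  move=> j; rewrite mem_rcons in_cons (perm_mem tA) !mem_enum !inE.
  by have [->|] := eqVneq j i.
exists (rcons t i); split=> // j.
have [jt|tj] := leqP j (size t).
  by rewrite -cats1 takel_cat// tB.
rewrite take_oversize ?size_rcons// (perm_big _ tiA) big_enum/=.
have -> : \sum_(i in A) y i = \sum_i l i *: y i + \sum_(i in A) (1 - l i) *: y i.
  have -> : \sum_i l i *: y i = \sum_(i in A) l i *: y i.
    rewrite [RHS]big_mkcond; apply: eq_bigr => h _; case: ifPn => // /lA ->.
    by rewrite scale0r.
  by rewrite -big_split/=; apply: eq_bigr => h _; rewrite -scalerDl subrKC scale1r.
apply: (le_trans (ler_normD _ _)); apply: lerD => //.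
apply: (le_trans (ler_norm_sum _ _ _)).
apply: (@le_trans _ _ (\sum_(i in A) (1 - l i) * M)).
  apply: ler_sum => h _; have /andP[l0 l1] := l01 h.
  by rewrite normrZ ger0_norm ?subr_ge0// ler_wpM2l// subr_ge0.
rewrite -mulr_suml -mulr_natl ler_wpM2r// sumrB sumr_const.
have -> : \sum_(h in A) l h = \sum_h l h.
  by rewrite [LHS]big_mkcond; apply: eq_bigr => h _; case: ifPn => // /lA.
by lra.
Qed.

(** Steinitz's lemma: start [steinitz_chain] with all weights equal to 1. *)
Lemma steinitz (R : realType) (I : eqType) d (y : I -> 'rV[R]_d) (M : R) (s : seq I) :
  0 <= M -> (forall i, i \in s -> `|y i| <= M) ->
  exists t : seq I, perm_eq t s /\
    forall j, `|\sum_(i <- take j t) y i| <= `|\sum_(i <- s) y i| + M *+ d.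
Proof.
move=> M0 yM; pose f := tnth (in_tuple s).
have [] := @steinitz_chain R 'I_(size s) d (fun k => y (f k)) M
  `|\sum_(i <- s) y i| finset.setT (fun=> 1) M0.
- by move=> k; rewrite yM// mem_tnth.
- by rewrite lexx ler01.
- by move=> k; rewrite inE.
- by rewrite cardsT card_ord sumr_const card_ord lerDl.
- rewrite [X in _ <= `|X|](big_tnth _ _ s).
  by rewrite (eq_bigr (fun k => y (f k)))// => k _; rewrite scale1r.
move=> t [tA tB]; exists (map f t); split.
  rewrite -[X in perm_eq _ X](map_tnth_enum (in_tuple s)).
  by rewrite perm_map// (perm_trans tA)// enum_setT enumT.
by move=> j; rewrite -map_take big_map tB.
Qed.

Local Open Scope classical_set_scope.

(** * Rearrangements of real series *)

Definition bounded_series (R : realType) (b : nat -> R) :=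
  exists K, forall n, series b n <= K.

Lemma bounded_series_cvg (R : realType) (b : nat -> R) :
  (forall i, 0 <= b i) -> bounded_series b -> cvgn (series b).
Proof.
move=> b0 [K bK]; apply: nondecreasing_is_cvgn.
  by apply: nondecreasing_series.
by exists K => _ [n _ <-].
Qed.

Lemma series_le_lim (R : realType) (b : nat -> R) (L : R) :
  (forall i, 0 <= b i) -> series b @ \oo --> L -> forall n, series b n <= L.
Proof.
move=> b0 bL n; rewrite -(cvg_lim _ bL)//.
apply: nondecreasing_cvgn_le; last by apply: cvgP bL.
exact: nondecreasing_series.
Qed.

Lemma bijective_inverse (s : nat -> nat) : bijective s ->
  exists r, [/\ bijective r, cancel s r & cancel r s].
Proof. by case=> r sr rs; exists r; split=> //; exists s. Qed.

Lemma ler_sum_uniq (R : realType) (I : eqType) (b : I -> R) (s t : seq I) :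
  (forall i, 0 <= b i) -> uniq s -> uniq t -> {subset s <= t} ->
  \sum_(i <- s) b i <= \sum_(i <- t) b i.
Proof.
move=> b0 us ut st; have st' : perm_eq s [seq i <- t | i \in s].
  apply: uniq_perm; rewrite ?filter_uniq// => i.
  by rewrite mem_filter andb_idr//; exact: st.
rewrite (perm_big _ st') big_filter [leRHS](bigID (mem s))/= lerDl.
by apply: sumr_ge0.
Qed.

Lemma series_rearr_le (R : realType) (b : nat -> R) (s : nat -> nat) (m : nat) :
  (forall i, 0 <= b i) -> injective s ->
  exists n, series (b \o s) m <= series b n.
Proof.
move=> b0 si; exists (\max_(i < m) s i).+1%N.
rewrite /series/= /index_iota !subn0 -(big_map s xpredT b).
apply: ler_sum_uniq; rewrite ?iota_uniq ?map_inj_uniq ?iota_uniq//.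
move=> i /mapP[j]; rewrite !mem_iota !add0n/= => jm ->.
by rewrite ltnS (@leq_bigmax _ (fun i : 'I_m => s i) (Ordinal jm)).
Qed.

(** Each partial sum of one series is below a partial sum of the other, and the
    relation between the two series is symmetric. *)
Lemma cvg_rearr_ge0 (R : realType) (b : nat -> R) (s : nat -> nat) (L : R) :
  (forall i, 0 <= b i) -> bijective s ->
  series b @ \oo --> L -> series (b \o s) @ \oo --> L.
Proof.
have le_rearr (c : nat -> R) (r : nat -> nat) (K : R) : (forall i, 0 <= c i) ->
    injective r -> series c @ \oo --> K -> forall m, series (c \o r) m <= K.
  move=> c0 ri cK m; have [n /le_trans] := series_rearr_le m c0 ri.
  by apply; exact: series_le_lim.
move=> b0 bs bL; have [r [rb sr rs]] := bijective_inverse bs.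
have bsK := le_rearr _ _ _ b0 (bij_inj bs) bL.
have bs0 i : 0 <= (b \o s) i by exact: b0.
have bsc : cvgn (series (b \o s)).
  by apply: bounded_series_cvg => //; exists L.
have brs : (b \o s) \o r = b by apply/funext => i /=; rewrite rs.
have Lb := le_rearr _ _ _ bs0 (bij_inj rb) bsc; rewrite brs in Lb.
have limL : limn (series (b \o s)) <= L.
  by apply: limr_le => //; apply: nearW.
have Llim : L <= limn (series (b \o s)).
  rewrite -(cvg_lim _ bL)//; apply: limr_le; first exact: cvgP bL.
  exact: nearW.
by have <- : limn (series (b \o s)) = L by apply: le_anti; rewrite limL Llim.
Qed.

(** [a] is the difference of the two non-negative summable sequences [`|a| + a]
    and [`|a|], each of which can be summed in any order. *)
Lemma abs_summable_cvg (R : realType) (a : nat -> R) :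
  bounded_series (fun i => `|a i|) -> exists r : R, forall s, bijective s ->
    series (a \o s) @ \oo --> r.
Proof.
move=> ab.
have /cvg_ex[/= L aL] : cvgn (series (fun i => `|a i|)) by exact: bounded_series_cvg.
have pos0 i : 0 <= `|a i| + a i by have := ler_norm (- a i); rewrite normrN; lra.
have /cvg_ex[/= P aP] : cvgn (series (fun i => `|a i| + a i)).
  apply: bounded_series_cvg => //; case: ab => K aK; exists (K + K) => n.
  apply: (@le_trans _ _ (series (fun i => `|a i|) n + series (fun i => `|a i|) n)).
    rewrite -big_split/=; apply: ler_sum => i _.
    by have := ler_norm (a i); lra.
  by rewrite lerD.
exists (P - L) => s sb.
have -> : series (a \o s) =
    series ((fun i => `|a i| + a i) \o s) - series ((fun i => `|a i|) \o s).
  apply/funext => n; rewrite /series /= !fctE /= -sumrB.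
  by apply: eq_bigr => i _ /=; rewrite addrC addKr.
exact: (cvgB (cvg_rearr_ge0 pos0 sb aP) (cvg_rearr_ge0 (fun i => normr_ge0 (a i)) sb aL)).
Qed.

(** Since [`|a| = 2 * max a 0 - a], bounded partial sums of the positive part and
    bounded partial sums of [a], in the same order, bound those of [`|a|]. *)
Lemma bounded_pos_abs (R : realType) (a : nat -> R) (s : nat -> nat) (r : R) :
  bijective s -> series (a \o s) @ \oo --> r ->
  bounded_series (fun i => Num.max (a i) 0) -> bounded_series (fun i => `|a i|).
Proof.
move=> sb asr [K aK].
have [M aM] : exists M, forall n, `|series (a \o s) n| <= M.
  have /cvg_seq_bounded [M [_ Mb]] := cvgP _ asr.
  by exists (M + 1) => n; apply: (Mb (M + 1)) => //; rewrite ltrDl.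
have [t [tb st ts]] := bijective_inverse sb.
exists (K + K + M) => n.
have [m] := series_rearr_le n (fun i => normr_ge0 (a (s i))) (bij_inj tb).
rewrite (_ : _ \o t = (fun i => `|a i|)); last first.
  by apply/funext => i /=; rewrite ts.
move=> /le_trans; apply.
have [k mk] : exists k, series ((fun i => Num.max (a i) 0) \o s) m <=
    series (fun i => Num.max (a i) 0) k.
  by apply: series_rearr_le (bij_inj sb) => i; rewrite le_max lexx orbT.
have -> : series (fun i => `|a (s i)|) m =
  series ((fun i => Num.max (a i) 0) \o s) m *+ 2 - series (a \o s) m.
  rewrite /series/= -sumrMnl -sumrB; apply: eq_bigr => i _.
  rewrite /= mulr2n; case: (leP 0 (a (s i))) => h.
    by rewrite ger0_norm// addrK.
  by rewrite ltr0_norm// add0r sub0r.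
have := aM m; have := aK k; move: mk; rewrite ler_norml => h1 h2 /andP[h3 _].
rewrite mulr2n; lra.
Qed.

(** The terms tend to 0 in the order that converges, and a permutation of the
    indices leaves every finite set of them eventually. *)
Lemma potentially_convergent_cvg0 (R : realType) (V : normedModType R) (a : nat -> V)
    (s : nat -> nat) (r : V) :
  bijective s -> series (a \o s) @ \oo --> r -> a @ \oo --> 0.
Proof.
move=> sb asr; have [t [tb st ts]] := bijective_inverse sb.
have as0 : (a \o s) @ \oo --> 0 by apply: cvg_series_cvg_0; exact: cvgP asr.
apply/cvgrPdist_le => e e0; move/cvgrPdist_le: as0 => /(_ e e0) [N _ aN].
exists (\max_(i < N) s i).+1%N => // n /= nN.
rewrite -(ts n); apply: aN => /=; rewrite leqNgt; apply/negP => tN.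
have := @leq_bigmax _ (fun i : 'I_N => s i) (Ordinal tN); rewrite /= ts.
by rewrite leqNgt nN.
Qed.

Lemma ereal_abs_summable (R : realType) (a : nat -> R) :
  (\sum_(0 <= n <oo) (`|a n|)%:E < +oo)%E <-> bounded_series (fun i => `|a i|).
Proof.
split.
- move=> aoo.
  have a0 : (0 <= \sum_(0 <= n <oo) (`|a n|)%:E)%E.
    by apply: nneseries_ge0 => n _ _; rewrite lee_fin.
  exists (fine (\sum_(0 <= n <oo) (`|a n|)%:E)%E) => n.
  rewrite -lee_fin fineK ?ge0_fin_numE// /series/= -sumEFin.
  by apply: nneseries_lim_ge => k _ _; rewrite lee_fin.
- move=> [K aK]; apply: (@le_lt_trans _ _ K%:E); last by rewrite ltry.
  apply: lime_le.
    by apply: is_cvg_nneseries => k _ _; rewrite lee_fin.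
  by apply: nearW => n; rewrite sumEFin lee_fin aK.
Qed.

(** * Convex sets and half-spaces in R^n *)

Lemma rV_coord_le (R : realType) n (v : 'rV[R]_n) (j : 'I_n) : `|v 0 j| <= `|v|.
Proof.
rewrite [leRHS]/Num.norm/= mx_normrE.
by apply/bigmax_geP; right => /=; exists (0, j).
Qed.

Lemma rV_norm_le (R : realType) n (v : 'rV[R]_n) (B : R) : 0 <= B ->
  (forall j, `|v 0 j| <= B) -> `|v| <= B.
Proof.
move=> B0 vB; rewrite [leLHS]/Num.norm/= mx_normrE.
by apply/bigmax_leP; split => // -[i j] _ /=; rewrite ord1.
Qed.

Lemma linear_rV_continuous (R : realType) n (W : normedModType R)
    (f : {linear 'rV[R]_n -> W}) : continuous f.
Proof.
apply/bounded_linear_continuous/linear_boundedP.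
near=> r => v; rewrite {1}(row_sum_delta v) linear_sum.
apply: (le_trans (ler_norm_sum _ _ _)).
apply: (@le_trans _ _ ((\sum_j `|f (delta_mx 0 j)|) * `|v|)).
  rewrite mulr_suml; apply: ler_sum => j _.
  by rewrite linearZ normrZ mulrC ler_wpM2l// rV_coord_le.
by apply: ler_wpM2r => //; near: r; apply: nbhs_pinfty_ge; rewrite num_real.
Unshelve. all: by end_near. Qed.

Definition dot (R : realType) n (u v : 'rV[R]_n) : R^o := \sum_j u 0 j * v 0 j.

Lemma dot_linear (R : realType) n (u : 'rV[R]_n) : linear (dot u).
Proof.
move=> a v w; rewrite /dot scaler_sumr -big_split/=; apply: eq_bigr => j _.
by rewrite !mxE mulrDr mulrCA.
Qed.

HB.instance Definition _ (R : realType) n (u : 'rV[R]_n) :=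
  GRing.isLinear.Build R 'rV[R]_n R^o *:%R (dot u) (dot_linear u).

Lemma dotC (R : realType) n (u v : 'rV[R]_n) : dot u v = dot v u.
Proof. by apply: eq_bigr => j _; rewrite mulrC. Qed.

Lemma dotvv_ge0 (R : realType) n (u : 'rV[R]_n) : 0 <= dot u u.
Proof. by apply: sumr_ge0 => j _; rewrite -expr2 sqr_ge0. Qed.

Lemma dotvv_eq0 (R : realType) n (u : 'rV[R]_n) : dot u u = 0 -> u = 0.
Proof.
move=> u0; apply/rowP => j; rewrite mxE; apply/eqP; rewrite -sqrf_eq0 expr2.
have h i : true -> 0 <= u 0 i * u 0 i by rewrite -expr2 sqr_ge0.
by rewrite (psumr_eq0P h u0).
Qed.

Lemma rV_norm_le_dot (R : realType) n (u : 'rV[R]_n) : `|u| <= 1 + dot u u.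
Proof.
apply: rV_norm_le => [|j]; first by rewrite addr_ge0// dotvv_ge0.
rewrite /dot (bigD1 j)//= -expr2.
have : 0 <= \sum_(i < n | i != j) u 0 i * u 0 i.
  by apply: sumr_ge0 => i _; rewrite -expr2 sqr_ge0.
by case: (ger0P (u 0 j)) => h; nra.
Qed.

Lemma dotDZ (R : realType) n (u v : 'rV[R]_n) (t : R) :
  dot (u + t *: v) (u + t *: v) = dot u u + 2 * t * dot u v + t ^+ 2 * dot v v.
Proof.
rewrite linearD/= linearZ/= [dot _ u]dotC [dot _ v]dotC !linearD/= !linearZ/=.
rewrite [dot v u]dotC /GRing.scale/=; ring.
Qed.

(** Separation of a point from a convex set: let [c0] be a point of the closure
    nearest to [p] for the Euclidean distance.  All of [C] lies in the half-space
    where [dot (p - c0)] is at most its value at [c0], hence so does [p], that is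
    [dot (p - c0) (p - c0) <= 0]. *)
Lemma mem_closure_of_halfspaces (R : realType) n (C : set 'rV[R]_n) (p : 'rV[R]_n) :
  C !=set0 ->
  (forall a b t, C a -> C b -> 0 <= t <= 1 -> C ((1 - t) *: a + t *: b)) ->
  (forall u (r : R), (forall c, C c -> dot u c <= r) -> dot u p <= r) ->
  closure C p.
Proof.
move=> [c1 Cc1] Cconv Chalf.
pose q (v : 'rV[R]_n) : R := dot (v - p) (v - p).
have q_cont : continuous q.
  apply: (@continuous_big R _ +%R 0 xpredT) => [|j _ v].
    exact: add_continuous.
  rewrite [X in continuous_at _ X](_ :
    _ = (fun x : 'rV[R]_n => (x 0 j - p 0 j) * (x 0 j - p 0 j))).
    have h : {for v, continuous (fun x : 'rV[R]_n => x 0 j - p 0 j)}.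
      have h1 : {for v, continuous (fun x : 'rV[R]_n => x 0 j)}.
        exact: coord_continuous.
      exact: (cvgB h1 (cvg_cst (p 0 j))).
    exact: (cvgM h h).
  by apply/funext => x; rewrite !mxE.
(* Cutting the closure at the distance of one point of [C] makes it compact. *)
pose K := closure C `&` [set v | q v <= q c1].
have Kc1 : K c1 by split=> /=; [exact: subset_closure|].
have K_compact : compact K.
  apply: bounded_closed_compact.
    exists (1 + q c1 + `|p|); split; first by rewrite num_real.
    move=> M KM v [_ /= vq]; rewrite (le_trans _ (ltW KM))//.
    rewrite -[v](subrK p) (le_trans (ler_normD _ _))// lerD2r.
    by rewrite (le_trans (rV_norm_le_dot _))// lerD2l.
  apply: closedI; first exact: closed_closure.
  apply: (@preimage_closed _ _ q [set x | x <= q c1]); last exact: closed_le.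
  by move=> x _; exact: q_cont.
have [c0 /set_mem[clc0 qc0] c0min'] := EVT_min_rV (ex_intro _ c1 Kc1) K_compact
  (continuous_subspaceT q_cont).
have c0min v : closure C v -> q c0 <= q v.
  move=> Cv; have [qv|/ltW qv] := leP (q v) (q c1).
    by apply: c0min'; apply/mem_set; split.
  exact: le_trans qc0 qv.
have seg c t : C c -> 0 <= t <= 1 -> closure C ((1 - t) *: c0 + t *: c).
  move=> Cc t01 B Bn.
  have fc : {for c0, continuous (fun v : 'rV[R]_n => (1 - t) *: v + t *: c)}.
    have h1 : {for c0, continuous (fun v : 'rV[R]_n => (1 - t) *: v)}.
      exact: scaler_continuous.
    exact: (cvgD h1 (cvg_cst (t *: c))).
  have [v [Cv Bv]] := clc0 _ (fc _ Bn).
  by exists ((1 - t) *: v + t *: c); split=> //; exact: Cconv.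
(* First-order optimality of [c0] along the segment from [c0] to [c]. *)
have obtuse c : C c -> 0 <= dot (c0 - p) (c - c0).
  move=> Cc; set D := dot _ _; set E := dot (c - c0) (c - c0).
  have E0 : 0 <= E by exact: dotvv_ge0.
  have DE t : 0 < t <= 1 -> 0 <= 2 * D + t * E.
    move=> /andP[t0 t1]; have t01 : 0 <= t <= 1 by rewrite (ltW t0).
    have := c0min _ (seg c t Cc t01).
    have -> : (1 - t) *: c0 + t *: c = c0 + t *: (c - c0).
      by rewrite scalerBl scale1r scalerBr addrA addrAC.
    rewrite /q addrAC dotDZ -/D -/E => h.
    rewrite -(pmulr_rge0 _ t0); nra.
  rewrite leNgt; apply/negP => D0.
  pose t := Num.min 1 (- D / (E + 1)).
  have E1 : 0 < E + 1 by lra.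
  have t0 : 0 < t by rewrite lt_min ltr01/= divr_gt0//; lra.
  have t1 : t <= 1 by rewrite ge_min lexx.
  have tE : t * (E + 1) <= - D by rewrite -ler_pdivlMr// ge_min lexx orbT.
  have := DE t; rewrite t0 t1 => /(_ isT); lra.
have := Chalf (p - c0) (dot (p - c0) c0).
have -> : dot (p - c0) p <= dot (p - c0) c0 = (dot (p - c0) (p - c0) <= 0).
  by rewrite linearB/= subr_le0.
move=> h; have /dotvv_eq0/eqP : dot (p - c0) (p - c0) = 0.
  apply/eqP; rewrite eq_le dotvv_ge0 andbT; apply: h => c /obtuse.
  by rewrite -opprB dotC linearN/= dotC oppr_ge0 linearB/= subr_le0.
by rewrite subr_eq0 => /eqP ->.
Qed.

(** * Approximation by sums over finite sets of indices *)

(** The partial sums are required to be eventually constant, rather than the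
    weights finitely supported, so that a convex combination only has to take the
    larger of two bounds [k]. *)
Definition weighted_tails (R : realType) n (y : nat -> 'rV[R]_n) (N : nat) : set 'rV[R]_n :=
  [set c | exists (l : nat -> R) (k : nat), [/\ forall i, 0 <= l i <= 1,
    forall i, (i < N)%N -> l i = 0 &
    forall m, (k <= m)%N -> series (fun i => l i *: y i) m = c]].

Lemma series_stationary (V : zmodType) (F : nat -> V) (k m : nat) : (k <= m)%N ->
  (forall i, (k <= i)%N -> F i = 0) -> series F m = series F k.
Proof.
move=> km F0; apply/eqP; rewrite -subr_eq0 sub_series_geq//.
by rewrite big_nat big1// => i /andP[ki _]; rewrite F0.
Qed.

Lemma weighted_tails_sum (R : realType) n (y : nat -> 'rV[R]_n) (N m : nat) (P : pred nat) :
  weighted_tails y N (\sum_(N <= i < m | P i) y i).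
Proof.
exists (fun i => ([&& N <= i, i < m & P i])%N%:R), m; split.
- by move=> i; case: [&& _, _ & _]; rewrite ?lexx ler01.
- by move=> i iN; rewrite leqNgt iN.
- move=> k mk; rewrite (series_stationary mk); last first.
    by move=> i mi; rewrite [(i < m)%N]ltnNge mi andbF scale0r.
  rewrite (@big_nat_widenl _ _ _ N 0 m)// /series/= [RHS]big_mkcond/=.
  apply: eq_big_nat => i /andP[_ im]; rewrite im andbC.
  by case: (P i && _); rewrite ?scale1r ?scale0r.
Qed.

Lemma weighted_tails_convex (R : realType) n (y : nat -> 'rV[R]_n) (N : nat) a b (t : R) :
  weighted_tails y N a -> weighted_tails y N b -> 0 <= t <= 1 ->
  weighted_tails y N ((1 - t) *: a + t *: b).
Proof.
move=> [l [k [l01 lN la]]] [l' [k' [l01' lN' lb]]] /andP[t0 t1].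
exists (fun i => (1 - t) * l i + t * l' i), (maxn k k'); split.
- move=> i; have /andP[? ?] := l01 i; have /andP[? ?] := l01' i.
  by apply/andP; split; nra.
- by move=> i iN; rewrite lN// lN'// !mulr0 addr0.
- move=> m; rewrite geq_max => /andP[km km'].
  rewrite -(la m)// -(lb m)// /series/= !scaler_sumr -big_split/=.
  by apply: eq_bigr => i _; rewrite !scalerA -scalerDl.
Qed.

Lemma series_linear (R : realType) (V W : lmodType R) (f : {linear V -> W})
    (y : nat -> V) m :
  series (f \o y) m = f (series y m).
Proof. by rewrite /series/= linear_sum. Qed.

(** A bound [r] of [dot u] on the weighted tails must also bound
    [dot u (s - series y N)]; this is where absolutely summable [u] and the other
    [u] are treated differently. *)
Lemma weighted_tails_closure (R : realType) n (y : nat -> 'rV[R]_n) (s : 'rV[R]_n)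
    (N : nat) :
  (forall u, exists r, potential_sums (dot u \o y : nat -> R^o) r) ->
  (forall u, bounded_series (fun i => `|dot u (y i)|) ->
     series (dot u \o y) @ \oo --> dot u s) ->
  closure (weighted_tails y N) (s - series y N).
Proof.
move=> ystar ys; apply: mem_closure_of_halfspaces.
- by exists (\sum_(N <= i < N | true) y i); exact: weighted_tails_sum.
- by move=> a b t; exact: weighted_tails_convex.
move=> u r ur; rewrite linearB/= lerBlDr.
(* Absolutely summable: the plain tail sums are weighted tails. *)
have [/ys us|nsum] := pselect (bounded_series (fun i => `|dot u (y i)|)).
  rewrite -(cvg_lim _ us)//; apply: limr_le; first exact: cvgP us.
  exists N => // m /= Nm; rewrite series_linear -lerBlDr -linearB/=.
  by rewrite sub_series_geq// ur//; exact: weighted_tails_sum.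
(* Not summable: the tail sums of the non-negative values are weighted tails,
   so the bound [r] would make the positive part summable. *)
exfalso; apply: nsum; have [r' [sg [sgb sgr]]] := ystar u.
apply: (bounded_pos_abs sgb sgr); set b := fun i => _.
exists (series b N + r) => m.
have b0 i : 0 <= b i by rewrite /b le_max lexx orbT.
apply: (@le_trans _ _ (series b (m + N)%N)).
  by apply: nondecreasing_series => //; exact: leq_addr.
rewrite series_addn lerD2l.
apply: le_trans (ur _ (weighted_tails_sum y N (m + N) (fun i => 0 <= dot u (y i)))).
rewrite linear_sum/= [leRHS]big_mkcond/=; apply: ler_sum => i _.
by rewrite /b /=; case: (leP 0 (dot u (y i))).
Qed.

Definition approximable (R : realType) n (y : nat -> 'rV[R]_n) (s : 'rV[R]_n) :=
  forall N (e : R), 0 < e ->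
  exists G : seq nat, [/\ uniq G, {subset iota 0 N <= G} &
    `|s - \sum_(i <- G) y i| <= e].

(** Past a large enough [N'] all terms are at most [e / 2 / n.+1], so rounding a
    weighted tail that is [e / 2]-close to [s - series y N'] costs at most
    another [e / 2]. *)
Lemma approx_finite (R : realType) n (y : nat -> 'rV[R]_n) (s : 'rV[R]_n) :
  y @ \oo --> (0 : 'rV[R]_n) -> (forall N, closure (weighted_tails y N) (s - series y N)) ->
  approximable y s.
Proof.
move=> y0 scl N e e0; pose M := e / 2 / n.+1%:R.
have M0 : 0 < M by rewrite !divr_gt0// ltr0n.
move/cvgr0Pnorm_le: (y0) => /(_ _ M0) [N0 _ yM'].
pose N' := maxn N N0.
have yM i : (N' <= i)%N -> `|y i| <= M.
  by move=> N'i; apply: yM'; apply: leq_trans N'i; rewrite leq_maxr.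
have e2 : 0 < e / 2 by rewrite divr_gt0.
have [c [[l [k [l01 lN lc]]] sc]] := scl N' _ (nbhsx_ballx _ _ e2).
have [||H [Hl Hle]] := @rounding R 'I_k n (fun i => y i) (fun i => l i) M (ltW M0).
- by move=> i; exact: l01.
- move=> i li; apply: yM; rewrite leqNgt; apply: contraNN li => iN.
  by rewrite lN.
exists (iota 0 N' ++ [seq val i | i <- enum H]); split.
- rewrite cat_uniq iota_uniq map_inj_uniq ?enum_uniq//=; last exact: val_inj.
  rewrite andbT; apply/hasPn => _ /mapP[i iH ->]; rewrite mem_iota/= add0n.
  by apply: contra (Hl i _) => [iN|]; [rewrite lN | rewrite -mem_enum].
- move=> i; rewrite mem_cat !mem_iota/= !add0n => iN.
  by rewrite (leq_trans iN)// leq_maxl.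
- rewrite big_cat/= big_map big_enum/=.
  have -> : \sum_(i <- iota 0 N') y i = series y N' by rewrite /series/= /index_iota subn0.
  have Hle' : `|c - \sum_(i in H) y i| <= M *+ n.
    by move: Hle; rewrite -(lc k)// /series/= big_mkord.
  rewrite opprD addrA -(subrKA c) (le_trans (ler_normD _ _))//.
  rewrite [leRHS]splitr lerD//; first by move: sc; rewrite -ball_normE => /ltW.
  apply: (le_trans Hle'); rewrite /M -mulr_natr mulrAC -mulrA ler_piMr ?(ltW e2)//.
  by rewrite ler_pdivrMr ?ltr0n// mul1r ler_nat.
Qed.

(** * Construction of the permutation *)

(** The invariant of the construction at stage [k].  The condition on the indices
    outside [l] makes the limit of the lists exhaust the indices and makes every
    term still to come small, as Steinitz's lemma requires. *)
Definition good_prefix (R : realType) n (y : nat -> 'rV[R]_n) (s : 'rV[R]_n) (k : nat)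
    (l : seq nat) :=
  [/\ uniq l, forall i, i \notin l -> (k <= i)%N /\ `|y i| <= k.+1%:R^-1 &
    `|s - \sum_(i <- l) y i| <= k.+1%:R^-1].

Lemma good_prefix_perm (R : realType) n (y : nat -> 'rV[R]_n) s k l l' :
  perm_eq l l' -> good_prefix y s k l -> good_prefix y s k l'.
Proof.
move=> ll' [lu lk ls]; split; first by rewrite -(perm_uniq ll').
  by move=> i; rewrite -(perm_mem ll'); exact: lk.
by rewrite -(perm_big _ ll').
Qed.

Lemma ex_good_prefix (R : realType) n (y : nat -> 'rV[R]_n) s k N :
  y @ \oo --> (0 : 'rV[R]_n) -> approximable y s ->
  exists G, good_prefix y s k G /\ {subset iota 0 N <= G}.
Proof.
move=> y0 ys.
have k0 : 0 < k.+1%:R^-1 :> R by rewrite invr_gt0 ltr0n.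
move/cvgr0Pnorm_le: (y0) => /(_ _ k0) [N0 _ yM].
have [G [Gu GN Gs]] := ys (maxn (maxn N N0) k) _ k0.
have inG i : (i < maxn (maxn N N0) k)%N -> i \in G.
  by move=> iN; apply: GN; rewrite mem_iota.
exists G; split.
  split=> // i iG.
  have : (maxn (maxn N N0) k <= i)%N by rewrite leqNgt; apply: contraNN iG; exact: inG.
  by rewrite !geq_max => /andP[/andP[_ N0i] ki]; split=> //; exact: yM.
by move=> i; rewrite mem_iota/= add0n => iN; apply: inG; rewrite !leq_max iN.
Qed.

(** The block [m] that extends [l] has a sum of norm at most [2 / k.+1], the
    difference of two approximations of [s], and terms of norm at most
    [1 / k.+1]; Steinitz's ordering keeps its partial sums within
    [(n + 2) / k.+1], and [l] itself misses [s] by at most [1 / k.+1]. *)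
Lemma extend_prefix (R : realType) n (y : nat -> 'rV[R]_n) s k l :
  y @ \oo --> (0 : 'rV[R]_n) -> approximable y s -> good_prefix y s k l ->
  exists m, good_prefix y s k.+1 (l ++ m) /\
    forall j, `|s - \sum_(i <- l ++ take j m) y i| <= k.+1%:R^-1 *+ (n + 3).
Proof.
move=> y0 ys [lu lk ls].
have k0 : 0 < k.+1%:R^-1 :> R by rewrite invr_gt0 ltr0n.
have [G [Gg lG]] := ex_good_prefix k.+1 (\max_(i <- l) i).+1 y0 ys.
have {}lG : {subset l <= G}.
  by move=> i il; apply: lG; rewrite mem_iota/= add0n ltnS (@leq_bigmax_seq _ _ _ id).
have yk i : i \in [seq i <- G | i \notin l] -> `|y i| <= k.+1%:R^-1.
  by rewrite mem_filter => /andP[/lk []].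
have [t [tG tj]] := steinitz (ltW k0) yk.
have [Gu _ _] := Gg.
have ltG : perm_eq G (l ++ t).
  rewrite perm_sym; apply: uniq_perm => //.
    rewrite cat_uniq lu (perm_uniq tG) filter_uniq// andbT/=.
    by apply/hasPn => i; rewrite (perm_mem tG) mem_filter => /andP[].
  move=> i; rewrite mem_cat (perm_mem tG) mem_filter.
  by case: (boolP (i \in l)) => //= /lG ->.
have ltg := good_prefix_perm ltG Gg.
exists t; split=> // j; case: (ltg) => _ _; rewrite !big_cat/= => lts.
have kk : k.+2%:R^-1 <= k.+1%:R^-1 :> R by rewrite lef_pV2 ?posrE ?ltr0n// ler_nat.
set A := \sum_(i <- l) y i in ls lts *; set B := \sum_(i <- t) y i in lts *.
have Bk : `|B| <= k.+1%:R^-1 *+ 2.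
  have -> : B = (s - A) - (s - (A + B)) by rewrite opprB [RHS]addrA subrKA addrC addKr.
  by rewrite mulr2n (le_trans (ler_normB _ _))// lerD// (le_trans lts).
have tj' : `|\sum_(i <- take j t) y i| <= k.+1%:R^-1 *+ (n + 2).
  by rewrite addnC mulrnDr (le_trans (tj j))// lerD2r -(perm_big _ tG).
by rewrite opprD addrA (le_trans (ler_normB _ _))// addnS mulrS lerD.
Qed.

Lemma bijective_inj_surj (f : nat -> nat) :
  injective f -> (forall i, exists j, f j = i) -> bijective f.
Proof.
move=> finj /choice[g gP]; exists g => // i.
by apply: finj; rewrite gP.
Qed.

(** The nested lists [L k] have a common limit, the sequence [sg].  It is
    injective as the lists are duplicate-free, and surjective as every [i] is in
    [L i.+1]. *)
Lemma approximable_potential (R : realType) n (y : nat -> 'rV[R]_n) s :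
  y @ \oo --> (0 : 'rV[R]_n) -> approximable y s -> potential_sums y s.
Proof.
move=> y0 ys; have [l0 [l0g _]] := ex_good_prefix 0 0 y0 ys.
have /choice[f fP] (kl : nat * seq nat) : exists m, good_prefix y s kl.1 kl.2 ->
    good_prefix y s kl.1.+1 (kl.2 ++ m) /\
    forall j, `|s - \sum_(i <- kl.2 ++ take j m) y i| <= kl.1.+1%:R^-1 *+ (n + 3).
  have [/(extend_prefix y0 ys)[m mP]|ng] := pselect (good_prefix y s kl.1 kl.2).
    by exists m.
  by exists [::].
pose L := fix L k := if k is k'.+1 then L k' ++ f (k', L k') else l0.
have Lg k : good_prefix y s k (L k).
  by elim: k => // k IH; have [] := fP (k, L k) IH.
have Lmem k i : (i < k)%N -> i \in L k.
  move=> ik; apply: contraT => iL; have [_ /(_ _ iL) [ki _] _] := Lg k.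
  by move: ik; rewrite ltnNge ki.
have Lu k : uniq (L k) by case: (Lg k).
have Lsize k : (k <= size (L k))%N.
  rewrite -[leqLHS](size_iota 0); apply: uniq_leq_size; first exact: iota_uniq.
  by move=> i; rewrite mem_iota => /andP[_]; exact: Lmem.
have Lnth k d i : (i < size (L k))%N -> nth 0 (L (d + k)%N) i = nth 0 (L k) i /\
    (i < size (L (d + k)))%N.
  move=> ik; elim: d => // d [IH1 IH2]; rewrite addSn/= nth_cat size_cat IH2.
  by split=> //; rewrite ltn_addr.
pose sg i := nth 0 (L i.+1) i.
have Lsg k i : (i < size (L k))%N -> nth 0 (L k) i = sg i.
  move=> ik; have [<- _] := Lnth k i.+1 i ik.
  by rewrite /sg; have [<- _] := Lnth i.+1 k i (Lsize i.+1); rewrite addnC.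
exists sg; split.
  apply: bijective_inj_surj.
    move=> a b; pose k := (maxn a b).+1.
    have ak : (a < size (L k))%N by rewrite (leq_trans _ (Lsize k))// ltnS leq_maxl.
    have bk : (b < size (L k))%N by rewrite (leq_trans _ (Lsize k))// ltnS leq_maxr.
    by rewrite -(Lsg k)// -(Lsg k b)// => /eqP; rewrite nth_uniq// => /eqP.
  move=> i; have iL := Lmem i.+1 i (ltnSn i).
  by exists (index i (L i.+1)); rewrite -(Lsg i.+1) ?index_mem// nth_index.
apply/cvgrPdist_le => e e0.
have en : 0 < e / (n + 3)%:R by rewrite divr_gt0// ltr0n addn3.
have [K _ Ke] := near_infty_natSinv_lt (PosNum en).
exists (size (L K)) => // m /= Km.
(* [k] is the stage of the block that contains the position [m]. *)
have [||k Lkm kmax] := @ex_maxnP (fun k => (size (L k) <= m)%N) m; first by exists K.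
  by move=> k; exact: leq_trans (Lsize k).
have Kk : (K <= k)%N by exact: kmax.
have mk : (m < size (L k.+1))%N by rewrite ltnNge; apply/negP => /kmax; rewrite ltnn.
have -> : series (y \o sg) m = \sum_(i <- L k ++ take (m - size (L k)) (f (k, L k))) y i.
  have -> : L k ++ take (m - size (L k)) (f (k, L k)) = take m (L k.+1).
    by rewrite /= take_cat ltnNge Lkm.
  rewrite -(map_nth_iota0 0 (ltnW mk)) big_map /series/= /index_iota subn0.
  apply: eq_big_seq => i; rewrite mem_iota/= add0n => im.
  by rewrite -(Lsg k.+1)// (leq_trans im)// ltnW.
have [_ /(_ (m - size (L k))%N)] := fP (k, L k) (Lg k).
move=> /le_trans; apply => /=.
have n3 : 0 < (n + 3)%:R :> R by rewrite ltr0n addn3.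
by rewrite -[leLHS]mulr_natr -ler_pdivlMr//; exact: ltW (Ke k Kk).
Qed.

(** * Sums in coordinates and passage to coordinates *)

(** A linear form on a subspace of row vectors is evaluation at a point.  Take a
    row-free matrix [B] of maximal height with rows in the subspace; by maximality
    its rows span it, and a right inverse of [B] solves for the values of the form
    on these rows. *)
Lemma linear_form_dot (R : realType) n (P : set 'rV[R]_n) (L : 'rV[R]_n -> R) :
  P 0 -> (forall a u v, P u -> P v -> P (a *: u + v) /\ L (a *: u + v) = a * L u + L v) ->
  exists s, forall u, P u -> L u = dot u s.
Proof.
move=> P0 PL.
have L0 : L 0 = 0.
  by have [_] := PL 1 0 0 P0 P0; rewrite scaler0 addr0 mul1r => h; lra.
have Lsum k (w : 'I_k -> R) (b : 'I_k -> 'rV[R]_n) : (forall i, P (b i)) ->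
    L (\sum_i w i *: b i) = \sum_i w i * L (b i).
  move=> Pb; suff [] : P (\sum_i w i *: b i) /\
    L (\sum_i w i *: b i) = \sum_i w i * L (b i) by [].
  elim/big_ind2 : _ => // [r1 u1 r2 u2 [Pu1 <-] [Pu2 <-]|i _].
    by have [] := PL 1 u1 u2 Pu1 Pu2; rewrite scale1r mul1r.
  by have [] := PL (w i) (b i) 0 (Pb i) P0; rewrite addr0 L0 addr0.
pose isbase k := `[< exists B : 'M[R]_(k, n), row_free B /\ forall i, P (row i B) >].
have [||k /asboolP[B [Bfree PB]] kmax] := @ex_maxnP isbase n.
- by exists 0%N; apply/asboolP; exists 0; split=> [|[]//]; rewrite /row_free mxrank0.
- by move=> k /asboolP[B [/eqP rB _]]; move: (rank_leq_col B); rewrite rB.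
have PsubB u : P u -> (u <= B)%MS.
  move=> Pu; apply: contraT => uB.
  suff /kmax : isbase (1 + k)%N by rewrite ltnn.
  apply/asboolP; exists (col_mx u B); split; last first.
    move=> i; case: (split_ordP i) => j ->; rewrite ?rowKu ?rowKd// ord1.
    by rewrite (_ : row 0 u = u)//; apply/rowP => h; rewrite mxE.
  rewrite /row_free eqn_leq rank_leq_row/=.
  have /eqP rB := Bfree; apply: (@leq_ltn_trans (\rank B)); first by rewrite rB.
  apply: rank_ltmx.
  rewrite ltmxE -!addsmxE addsmxSr/= addsmx_sub negb_and uB//.
have /row_freeP[B' BB'] := Bfree.
pose c : 'cV[R]_k := \col_i L (row i B).
exists (B' *m c)^T => u /[dup] Pu /PsubB/submxP[w uw].
have -> : dot u (B' *m c)^T = (u *m (B' *m c)) 0 0.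
  by rewrite mxE; apply: eq_bigr => j _; rewrite mxE.
rewrite uw -mulmxA [B *m _]mulmxA BB' mul1mx mulmx_sum_row Lsum// mxE.
by apply: eq_bigr => i _; rewrite mxE.
Qed.

Lemma star_coord_cvg0 (R : realType) n (y : nat -> 'rV[R]_n) :
  (forall u, exists r, potential_sums (dot u \o y : nat -> R^o) r) ->
  y @ \oo --> (0 : 'rV[R]_n).
Proof.
move=> ystar; apply/cvgr0Pnorm_le => e e0.
have coord (j : 'I_n) : \forall i \near \oo, `|y i 0 j| <= e.
  have [r [sg [sgb sgr]]] := ystar (delta_mx 0 j).
  have := potentially_convergent_cvg0 sgb sgr; move/cvgr0Pnorm_le => /(_ _ e0).
  apply: filterS => i /=; rewrite /dot (bigD1 j)//= big1 ?addr0.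
    by rewrite mxE !eqxx mul1r.
  by move=> h hj; rewrite mxE (negbTE hj) andbF mul0r.
near=> i; apply: rV_norm_le; first exact: ltW.
by near: i; exact: filter_forall.
Unshelve. all: by end_near. Qed.

(** The functionals [u] with absolutely summable values form a subspace on which
    the sum of the values is linear in [u]. *)
Lemma coord_sum_exists (R : realType) n (y : nat -> 'rV[R]_n) :
  exists s, forall u, bounded_series (fun i => `|dot u (y i)|) ->
    series (dot u \o y) @ \oo --> dot u s.
Proof.
pose P := [set u : 'rV[R]_n | bounded_series (fun i => `|dot u (y i)|)].
have Pcvg u : P u -> series (dot u \o y) @ \oo --> limn (series (dot u \o y)).
  move=> /abs_summable_cvg[r /(_ id)] /= h.
  have {}h : series (dot u \o y) @ \oo --> r by apply: h; exists id.
  by rewrite (cvg_lim _ h).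
have [||s sP] := @linear_form_dot R n P (fun u => limn (series (dot u \o y))).
- exists 0 => m; rewrite /series/= big1// => i _.
  by rewrite dotC linear0 normr0.
- move=> a u v Pu Pv.
  have duv i : dot (a *: u + v) (y i) = a * dot u (y i) + dot v (y i).
    by rewrite dotC linearP/= !(dotC (y i)).
  split.
    have [[K uK] [K' vK']] := (Pu, Pv); exists (`|a| * K + K') => m.
    apply: (@le_trans _ _ (`|a| * series (fun i => `|dot u (y i)|) m +
                           series (fun i => `|dot v (y i)|) m)).
      rewrite /series/= mulr_sumr -big_split/=; apply: ler_sum => i _.
      by rewrite duv -normrM ler_normD.
    by rewrite lerD// ler_wpM2l.
  apply/cvg_lim => //.
  have -> : series (dot (a *: u + v) \o y) =
      (fun m => a * series (dot u \o y) m + series (dot v \o y) m).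
    apply/funext => m; rewrite /series/= mulr_sumr -big_split/=.
    by apply: eq_bigr => i _; rewrite duv.
  by apply: cvgD; [apply: cvgM; [exact: cvg_cst|exact: Pcvg]|exact: Pcvg].
by exists s => u Pu; rewrite -sP//; exact: Pcvg.
Qed.

Lemma potential_sum_coord (R : realType) n (y : nat -> 'rV[R]_n) (s : 'rV[R]_n) :
  (forall u, exists r, potential_sums (dot u \o y : nat -> R^o) r) ->
  (forall u, bounded_series (fun i => `|dot u (y i)|) ->
     series (dot u \o y) @ \oo --> dot u s) ->
  potential_sums y s.
Proof.
move=> ystar ys; have y0 := star_coord_cvg0 ystar.
apply: approximable_potential => //; apply: approx_finite => // N.
exact: weighted_tails_closure.
Qed.

Lemma linear_coordinates (R : realType) (X : normedModType R) :
  finite_dimensional X -> exists (n : nat) (phi : {linear X -> 'rV[R]_n})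
    (psi : {linear 'rV[R]_n -> X}), cancel phi psi /\ cancel psi phi.
Proof.
move=> [n [[f flin [g fg gf]]]].
have glin : linear g.
  by move=> a u v; apply: (can_inj fg); rewrite flin !gf.
pose phi : {linear X -> 'rV[R]_n} :=
  HB.pack f (GRing.isLinear.Build R X 'rV[R]_n *:%R f flin).
pose psi : {linear 'rV[R]_n -> X} :=
  HB.pack g (GRing.isLinear.Build R 'rV[R]_n X *:%R g glin).
by exists n, phi, psi.
Qed.

(** The continuous function [`|psi v|] has a positive minimum on the unit sphere
    of row vectors, whose inverse is a Lipschitz constant of [phi]. *)
Lemma linear_to_rV_continuous (R : realType) (X : normedModType R) n
    (phi : {linear X -> 'rV[R]_n}) (psi : {linear 'rV[R]_n -> X}) :
  cancel phi psi -> cancel psi phi -> continuous phi.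
Proof.
move=> phiK psiK.
suff [K Kphi] : exists K, forall x, `|phi x| <= K * `|x|.
  apply/bounded_linear_continuous/linear_boundedP.
  apply: filterS (nbhs_pinfty_ge (num_real K)) => r Kr x.
  by rewrite (le_trans (Kphi x))// ler_wpM2r.
pose S := [set v : 'rV[R]_n | `|v| = 1].
have normalize v : v != 0 -> S (`|v|^-1 *: v).
  by move=> v0; rewrite /S/= normrZ normfV normr_id mulVf// normr_eq0.
have [S0|S0] := pselect (S !=set0); last first.
  exists 0 => x; rewrite mul0r normr_le0; apply: contraT => /normalize Sx.
  by case: S0; eexists; exact: Sx.
have psi_cont : continuous (fun v => `|psi v| : R).
  move=> v; exact: (cvg_norm (@linear_rV_continuous _ _ _ psi v)).
have S_compact : compact S.
  apply: bounded_closed_compact.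
    by exists 1; split; [exact: num_real|move=> M M1 v /= ->; exact: ltW].
  apply: (@preimage_closed _ _ (fun v : 'rV[R]_n => `|v|) [set 1]).
    by move=> v _; exact: norm_continuous.
  exact: closed_eq.
have [c /set_mem Sc cmin] := EVT_min_rV S0 S_compact (continuous_subspaceT psi_cont).
have c0 : 0 < `|psi c|.
  rewrite normr_gt0; apply/eqP => /(congr1 phi); rewrite psiK linear0 => c0.
  by move: Sc; rewrite /S/= c0 normr0 => /esym/eqP; rewrite oner_eq0.
exists (`|psi c|^-1) => x; have [->|px0] := eqVneq (phi x) 0.
  by rewrite normr0 mulr_ge0// invr_ge0.
have := cmin _ (mem_set (normalize _ px0)).
rewrite linearZ/= phiK normrZ normfV normr_id => h.
by rewrite mulrC ler_pdivlMr// -ler_pdivlMl ?normr_gt0.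
Qed.

(** * The set of potential sums *)

Lemma potential_sums_image (R : realType) (X Y : normedModType R) (f : {linear X -> Y})
    (x : nat -> X) (s : X) :
  continuous f -> potential_sums x s -> potential_sums (f \o x) (f s).
Proof.
move=> fc [sg [sgb xs]]; exists sg; split=> //.
have -> : series ((f \o x) \o sg) = f \o series (x \o sg).
  by apply/funext => m; rewrite -[RHS]series_linear.
exact: (continuous_cvg _ (fc s) xs).
Qed.

Lemma Gamma_sum (R : realType) (X : normedModType R) (x : nat -> X) (s : X)
    (f : {linear X -> R^o}) :
  potential_sums x s -> Gamma x f -> series (f \o x : nat -> R) @ \oo --> (f s : R).
Proof.
move=> xs [fc /ereal_abs_summable fx].
have [sg [sgb fxs]] := potential_sums_image fc xs.
have [r hr] := abs_summable_cvg fx.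
suff -> : f s = r by apply: (hr id); exists id.
by rewrite -(cvg_lim _ fxs)// -(cvg_lim _ (hr _ sgb)).
Qed.

Lemma potential_star (R : realType) (X : normedModType R) (x : nat -> X) (s : X) :
  potential_sums x s -> star_potentially_convergent x.
Proof. by move=> xs f fc; exists (f s); exact: potential_sums_image. Qed.

(** The conditions on [s] transfer to coordinates because every functional
    [dot u] composed with [phi] is continuous on [X]. *)
Lemma potential_sumsP (R : realType) (X : normedModType R) (x : nat -> X) (s : X) :
  finite_dimensional X -> star_potentially_convergent x ->
  potential_sums x s <->
  forall f, Gamma x f -> series (f \o x : nat -> R) @ \oo --> (f s : R).
Proof.
move=> X_findim x_star; split=> [xs f|xs]; first exact: Gamma_sum.
have [n [phi [psi [phiK psiK]]]] := linear_coordinates X_findim.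
have phi_cont := linear_to_rV_continuous phiK psiK.
have dot_cont u : continuous (dot u \o phi : {linear X -> R^o}).
  by move=> v; apply: continuous_comp; [exact: phi_cont|exact: linear_rV_continuous].
have -> : x = psi \o (phi \o x) by apply/funext => i /=; rewrite phiK.
rewrite -[s]phiK; apply: potential_sums_image; first exact: linear_rV_continuous.
apply: potential_sum_coord => u.
  exact: (x_star _ (dot_cont u)).
move=> ub; apply: (xs (dot u \o phi : {linear X -> R^o})); split; first exact: dot_cont.
exact/ereal_abs_summable.
Qed.

(** In coordinates every functional [f] is [dot u], with [u] the row of its values
    on the images of the standard basis. *)
Lemma potential_sum_exists (R : realType) (X : normedModType R) (x : nat -> X) :
  finite_dimensional X -> star_potentially_convergent x ->
  exists s, potential_sums x s.
Proof.
move=> X_findim x_star.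
have [n [phi [psi [phiK psiK]]]] := linear_coordinates X_findim.
have [s sP] := coord_sum_exists (phi \o x).
exists (psi s); apply/(potential_sumsP _ X_findim x_star) => f [_ /ereal_abs_summable fx].
pose u := \row_j f (psi (delta_mx 0 j)).
have fu v : f v = dot u (phi v).
  rewrite -{1}[v]phiK {1}(row_sum_delta (phi v)) !linear_sum/=.
  by apply: eq_bigr => j _; rewrite !linearZ/= mxE mulrC.
have fxE : f \o x = dot u \o (phi \o x) by apply/funext => i /=; rewrite fu.
rewrite fu psiK fxE; apply: sP.
by under eq_fun do rewrite -[dot _ _]fu.
Qed.

(** Every [f] in [Gamma x] takes one value on all potential sums, and an affine
    combination preserves it. *)
Lemma potential_sums_affine (R : realType) (X : normedModType R) (x : nat -> X) :
  finite_dimensional X -> affine_set (potential_sums x).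
Proof.
move=> X_findim n a t at_ t1.
case: n a t at_ t1 => [|n] a t ax t1.
  by move: t1; rewrite big_ord0 => /esym/eqP; rewrite oner_eq0.
have x_star := potential_star (ax ord0).
apply/(potential_sumsP _ X_findim x_star) => f fG.
suff -> : f (\sum_(i < n.+1) t i *: a i) = f (a ord0) by exact: Gamma_sum.
rewrite linear_sum/= (eq_bigr (fun i => t i * f (a ord0))).
  by rewrite -mulr_suml t1 mul1r.
move=> i _; rewrite linearZ/=; congr (_ * _).
by rewrite -(cvg_lim _ (Gamma_sum (ax i) fG))// -(cvg_lim _ (Gamma_sum (ax ord0) fG)).
Qed.

Lemma potential_sums_Gamma_perp (R : realType) (X : normedModType R) (x : nat -> X) :
  finite_dimensional X ->
  potential_sums x = set_sum (potential_sums x) (Gamma_perp x).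
Proof.
move=> X_findim; apply/seteqP; split=> [s xs|_ [s xs [v vG <-]]].
  by exists s => //; exists 0; rewrite ?addr0// => f _ /=; rewrite linear0.
apply/(potential_sumsP _ X_findim (potential_star xs)) => f fG.
by rewrite linearD/= (vG f fG) addr0; exact: Gamma_sum.
Qed.

Theorem theorem1 (R : realType) (X : completeNormedModType R)
    (X_findim : finite_dimensional X) (x : nat -> X) :
  affine_set (potential_sums x)
  /\ potential_sums x = set_sum (potential_sums x) (Gamma_perp x)
  /\ ((potential_sums x !=set0)%classic <-> star_potentially_convergent x).
Proof.
split; first exact: potential_sums_affine.
split; first exact: potential_sums_Gamma_perp.
split=> [[s]|x_star]; first exact: potential_star.
exact: potential_sum_exists.
Qed.
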